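(* Let $\mathbb{F}$ be a field of characteristic not $2$ or $3$, let $\eta\in\mathbb{F}$ with $\eta\notin\{1,\frac12\}$, and let $A$ be a primitive $\mathcal{PC}(\eta)$-axial algebra over $\mathbb{F}$. Then: (i) if $\eta=-1$, then $A$ is a pseudo-composition algebra; (ii) if $\eta\neq-1$, then $A$ is a train algebra of rank $3$.
   Context: Algebras are not assumed associative or unital. For a commutative $\mathbb{F}$-algebra $A$, $a\in A$ and $\lambda\in\mathbb{F}$, put $A_\lambda(a)=\{u\in A\mid au=\lambda u\}$. A ($\mathcal{PC}(\eta)$-)axis in $A$ is an idempotent $a\in A$ such that $A=A_1(a)\oplus A_\eta(a)\oplus A_{1/2}(a)$ and the fusion law $\mathcal{PC}(\eta)$ holds: $A_1(a)A_1(a)\subseteq A_1(a)$, $A_1(a)A_\eta(a)\subseteq A_\eta(a)$, $A_1(a)A_{1/2}(a)\subseteq A_{1/2}(a)$, $A_\eta(a)A_\eta(a)\subseteq A_1(a)$, $A_\eta(a)A_{1/2}(a)\subseteq A_{1/2}(a)$, $A_{1/2}(a)A_{1/2}(a)\subseteq A_1(a)\oplus A_\eta(a)$. An axis $a$ is primitive if $A_1(a)=\langle a\rangle$ is $1$-dimensional. A $\mathcal{PC}(\eta)$-axial algebra is a commutative $\mathbb{F}$-algebra generated by a set of axes; it is primitive if it is generated by a (non-empty) set of primitive axes. A pseudo-composition algebra (over a field of characteristic not $2$ or $3$) is a commutative $\mathbb{F}$-algebra $A$ with a non-zero symmetric bilinear form $\varphi$ such that $x^3=\varphi(x,x)x$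 for all $x\in A$. Principal powers are $x^1=x$, $x^i=x^{i-1}x$. A commutative $\mathbb{F}$-algebra $A$ is a train algebra of rank $3$ if there exist a non-zero algebra homomorphism $\omega:A\to\mathbb{F}$ and $\lambda_1,\lambda_2\in\mathbb{F}$ such that $x^3+\lambda_1\omega(x)x^2+\lambda_2\omega(x)^2x=0$ for all $x\in A$. *)

(* Defs.v *)
From mathcomp Require Import all_boot all_algebra.
From mathcomp Require Import classical_sets.

Set Implicit Arguments.
Unset Strict Implicit.
Unset Printing Implicit Defensive.

Import GRing.Theory.
Local Open Scope classical_set_scope.
Local Open Scope ring_scope.

(* Commutative algebras, neither associative nor unital, and of arbitrary
   (possibly infinite) dimension. *)
Record comAlg (F : fieldType) := ComAlg {
  comAlg_lmod :> lmodType F;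
  amul : {bilinear comAlg_lmod -> comAlg_lmod -> comAlg_lmod};
  amulC : commutative amul
}.

Notation "x ** y" := (amul _ x y) (at level 40, left associativity) : ring_scope.

Section CommutativeAlgebra.

Variables (F : fieldType) (A : comAlg F).
Implicit Types (U V W X : set A) (a x : A) (lambda eta : F).

(* x^1 = x and x^i = x^(i-1) x; the value at i = 0 is junk. *)
Definition ppow x (i : nat) : A := iter i.-1 (fun y => y ** x) x.

Definition eigenspace lambda a : set A := [set u | a ** u = lambda *: u].

Definition prodset U V : set A := [set u ** v | u in U & v in V].

Definition sumset U V : set A := [set u + v | u in U & v in V].

Definition direct_decomposition U V W : Prop :=
  (forall x, exists u v w, [/\ U u, V v, W w & x = u + v + w]) /\
  (forall u v w, U u -> V v -> W w -> u + v + w = 0 ->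
     [/\ u = 0, v = 0 & w = 0]).

Definition fusion_law eta a : Prop :=
  let A1 := eigenspace 1 a in
  let Aeta := eigenspace eta a in
  let Ahalf := eigenspace 2^-1 a in
  [/\ prodset A1 A1 `<=` A1,
      prodset A1 Aeta `<=` Aeta
    & prodset A1 Ahalf `<=` Ahalf] /\
  [/\ prodset Aeta Aeta `<=` A1,
      prodset Aeta Ahalf `<=` Ahalf
    & prodset Ahalf Ahalf `<=` sumset A1 Aeta].

Definition axis eta a : Prop :=
  [/\ a ** a = a,
      direct_decomposition
        (eigenspace 1 a) (eigenspace eta a) (eigenspace 2^-1 a)
    & fusion_law eta a].

Definition primitive_axis eta a : Prop :=
  [/\ axis eta a, a != 0 & eigenspace 1 a = range (fun c : F => c *: a)].

Definition subalgebra U : Prop :=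
  [/\ U 0, forall c x y, U x -> U y -> U (c *: x + y)
    & forall x y, U x -> U y -> U (x ** y)].

Definition generated_by X : Prop :=
  forall U, subalgebra U -> X `<=` U -> U = setT.

Definition primitive_axial_algebra eta : Prop :=
  exists X, [/\ X !=set0, forall a, X a -> primitive_axis eta a
              & generated_by X].

(* The restriction on the characteristic of F is not part of this predicate. *)
Definition pseudo_composition_algebra : Prop :=
  exists phi : {symmetric A},
    (exists x y, phi x y != 0) /\
    (forall x, ppow x 3 = phi x x *: x).

Definition train_algebra_rank3 : Prop :=
  exists (omega : {scalar A}) (lambda1 lambda2 : F),
    [/\ forall x y, omega (x ** y) = omega x * omega y,
        exists x, omega x != 0
      & forall x, ppow x 3 + (lambda1 * omega x) *: ppow x 2
                  + (lambda2 * omega x ^+ 2) *: x = 0].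

End CommutativeAlgebra.

(* Main.v *)
(* For a primitive axis a write lam_a(x) for the coefficient of a in the Peirce
   decomposition x = lam_a(x) a + x_eta + x_{1/2}.  The fusion law makes
   x |-> lam_a(x) a + x_eta - x_{1/2} an automorphism, and a b is a combination
   of a, b and the image of b under it; hence A is spanned by its primitive
   axes.  Comparing components in b^2 = b and in
   (L_b - 1/2)(L_b - eta) a = lam_b(a) (1 - eta)/2 b, where L_b is the
   multiplication by b, gives lam_a(b) = lam_b(a), with common value 1 when
   eta <> -1.  So there is a symmetric bilinear form phi with
   phi(a, x) = lam_a(x) for every primitive axis a; invariance under the
   automorphisms above makes A_eta(a) and A_{1/2}(a) orthogonal, so
   phi(x y, z) = phi(y, x z).  Both cases are then instances of
     x^3 - (1 + eta) omega(x) x^2 + eta phi(x, x) x = 0,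
   where omega = 0 if eta = -1, and omega = lam_a for every primitive axis a
   otherwise.  After polarization (this uses 1/3) it is enough to take one of
   the three arguments to be an axis a and to evaluate on the eigenspaces of
   L_a. *)

Require Import Defs.
From HB Require Import structures.
From mathcomp Require Import all_boot all_algebra.
From mathcomp Require Import classical_sets.
From mathcomp Require Import boolp ring.

Local Open Scope ring_scope.

Import GRing.Theory.

(** * Equalities between linear combinations *)

Section LinearCombinations.

Context {F : fieldType} {V : lmodType F}.

Inductive lin_expr :=
  | LVar of nat | LZero | LAdd of lin_expr & lin_expr
  | LOpp of lin_expr | LScale of F & lin_expr.

Fixpoint lin_eval (env : seq V) (e : lin_expr) : V :=
  match e with
  | LVar i => nth 0 env i
  | LZero => 0
  | LAdd e1 e2 => lin_eval env e1 + lin_eval env e2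
  | LOpp e1 => - lin_eval env e1
  | LScale c e1 => c *: lin_eval env e1
  end.

Fixpoint lin_coef (e : lin_expr) (i : nat) : F :=
  match e with
  | LVar j => if Nat.eqb i j then 1 else 0
  | LZero => 0
  | LAdd e1 e2 => lin_coef e1 i + lin_coef e2 i
  | LOpp e1 => - lin_coef e1 i
  | LScale c e1 => c * lin_coef e1 i
  end.

Fixpoint lin_wf (n : nat) (e : lin_expr) : bool :=
  match e with
  | LVar j => (j < n)%N
  | LZero => true
  | LAdd e1 e2 => lin_wf n e1 && lin_wf n e2
  | LOpp e1 => lin_wf n e1
  | LScale c e1 => lin_wf n e1
  end.

Lemma lin_evalE (env : seq V) (e : lin_expr) : lin_wf (size env) e ->
  lin_eval env e = \sum_(i < size env) lin_coef e i *: nth 0 env i.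
Proof.
elim: e => [j|| e1 IH1 e2 IH2|e IH|c e IH] /=.
- move=> ltj; rewrite (bigD1 (Ordinal ltj)) //= PeanoNat.Nat.eqb_refl scale1r.
  rewrite big1 ?addr0 // => i /eqP neij.
  case: PeanoNat.Nat.eqb_spec => [eij|_]; last by rewrite scale0r.
  by case: neij; apply/val_inj.
- by move=> _; rewrite big1 // => i _; rewrite scale0r.
- case/andP=> /IH1-> /IH2->; rewrite -big_split /=.
  by apply: eq_bigr => i _; rewrite scalerDl.
- by move/IH->; rewrite -sumrN; apply: eq_bigr => i _; rewrite scaleNr.
- by move/IH->; rewrite scaler_sumr; apply: eq_bigr => i _; rewrite scalerA.
Qed.

(** Recursion on [n] lets the predicate unfold, for a concrete environment, to a conjunction of
    scalar equations that [ring] or [field] closes one by one. *)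
Fixpoint coefs_eq (n : nat) (e1 e2 : lin_expr) : Prop :=
  match n with
  | 0 => True
  | S n' => lin_coef e1 n' = lin_coef e2 n' /\ coefs_eq n' e1 e2
  end.

Lemma lin_eval_eq (env : seq V) (e1 e2 : lin_expr) :
  lin_wf (size env) e1 && lin_wf (size env) e2 ->
  coefs_eq (size env) e1 e2 -> lin_eval env e1 = lin_eval env e2.
Proof.
case/andP=> /lin_evalE-> /lin_evalE-> eqc; apply: eq_bigr => -[i lti] _ /=.
congr (_ *: _); elim: (size env) lti eqc => //= n IH.
by rewrite ltnS leq_eqVlt => /predU1P[-> []|/IH lti [_ /lti]].
Qed.

End LinearCombinations.

Ltac lin_index x env :=
  match env with
  | ?y :: ?env' =>
      match constr:(Set) with
      | _ => let _ := match constr:(Set) with _ => constr_eq x y end in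
             constr:(0%N)
      | _ => let n := lin_index x env' in constr:(S n)
      end
  end.

Ltac lin_env t env :=
  match t with
  | @Algebra.add _ ?x ?y => let env1 := lin_env x env in lin_env y env1
  | @Algebra.opp _ ?x => lin_env x env
  | @GRing.scale _ _ _ ?x => lin_env x env
  | @Algebra.zero _ => env
  | _ => match constr:(Set) with
         | _ => let _ := lin_index t env in env
         | _ => constr:(t :: env)
         end
  end.

Ltac lin_reify F t env :=
  match t with
  | @Algebra.add _ ?x ?y =>
      let ex := lin_reify F x env in
      let ey := lin_reify F y env in constr:(LAdd (F := F) ex ey)
  | @Algebra.opp _ ?x =>
      let ex := lin_reify F x env in constr:(LOpp (F := F) ex)
  | @GRing.scale _ _ ?c ?x =>
      let ex := lin_reify F x env in constr:(LScale (F := F) c ex)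
  | @Algebra.zero _ => constr:(LZero (F := F))
  | _ => let n := lin_index t env in constr:(LVar (F := F) n)
  end.

(* Splits an equality of linear combinations over the field [F] into the
   equalities of the coefficients of syntactically equal vectors. *)
Ltac by_coefs F V :=
  match goal with |- ?l = ?r =>
    let env0 := constr:(@nil V) in
    let env1 := lin_env l env0 in
    let env := lin_env r env1 in
    let el := lin_reify F l env in
    let er := lin_reify F r env in
    apply: (@lin_eval_eq F _ env el er isT); cbn -[GRing.mul Algebra.add];
    repeat split
  end.


(** * Bilinearity rules for the product *)

Section CommutativeAlgebra.

Context {F : fieldType} {A : comAlg F}.
Implicit Types (a b x y z u v w : A) (c d k : F).

Lemma amulDl x y z : (x + y) ** z = x ** z + y ** z.
Proof. exact: linearDl. Qed.

Lemma amulDr x y z : z ** (x + y) = z ** x + z ** y.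
Proof. exact: linearDr. Qed.

Lemma amulZl c x z : (c *: x) ** z = c *: (x ** z).
Proof. exact: linearZl_LR. Qed.

Lemma amulZr c x z : z ** (c *: x) = c *: (z ** x).
Proof. exact: linearZr_LR. Qed.

Lemma amulNl x z : (- x) ** z = - (x ** z).
Proof. exact: linearNl. Qed.

Lemma amulNr x z : z ** (- x) = - (z ** x).
Proof. exact: linearNr. Qed.

Lemma amul0l x : 0 ** x = 0.
Proof. exact: linear0l. Qed.

Lemma amul0r x : x ** 0 = 0.
Proof. exact: linear0r. Qed.

Definition amulE := (amulDl, amulDr, amulZl, amulZr, amulNl, amulNr).

End CommutativeAlgebra.

(** * Peirce decomposition relative to a primitive axis *)

Section PrimitiveAxes.

Context {F : fieldType} {eta : F} {A : comAlg F}.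
Hypotheses (two_neq0 : 2 != 0 :> F) (three_neq0 : 3 != 0 :> F).
Hypotheses (eta_neq1 : eta != 1) (eta_neq_half : eta != 2^-1).
Implicit Types (a b x y z u v w : A) (c d k : F).

Definition peirce a x c u v : Prop :=
  [/\ a ** u = eta *: u, a ** v = 2^-1 *: v & x = c *: a + u + v].

(* Junk value 0 when [x] has no Peirce decomposition. *)
Definition coord a x : F :=
  xget 0 [set c | exists u v, peirce a x c u v]%classic.

Lemma eta2_neq1 : 1 - 2 * eta != 0.
Proof.
apply: contra eta_neq_half; rewrite subr_eq0 => /eqP eta2.
by apply/eqP; rewrite -[LHS](mulKf two_neq0) -eta2 mulr1.
Qed.

Lemma prim_idem {a} : primitive_axis eta a -> a ** a = a.
Proof. by case=> -[]. Qed.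

Lemma prim_neq0 {a} : primitive_axis eta a -> a != 0.
Proof. by case. Qed.

Lemma peirce_indep {a c u v} : primitive_axis eta a ->
  a ** u = eta *: u -> a ** v = 2^-1 *: v -> c *: a + u + v = 0 ->
  [/\ c = 0, u = 0 & v = 0].
Proof.
case=> -[_ [_ indep] _] a0 E1 au av sum0.
have [|/eqP + -> ->] := indep (c *: a) u v _ au av sum0.
  by rewrite E1; exists c.
by rewrite scaler_eq0 (negPf a0) orbF => /eqP.
Qed.

Lemma peirce_uniq {a x c u v c' u' v'} : primitive_axis eta a ->
  peirce a x c u v -> peirce a x c' u' v' -> [/\ c = c', u = u' & v = v'].
Proof.
move=> pa [au av ->] [au' av' eqx].
have [|||/eqP + /eqP + /eqP] := @peirce_indep a (c - c') (u - u') (v - v') pa.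
- by rewrite !amulE au au' scalerBr.
- by rewrite !amulE av av' scalerBr.
- transitivity (c *: a + u + v - (c' *: a + u' + v')).
    by by_coefs F A; ring.
  by rewrite eqx subrr.
by rewrite !subr_eq0 => /eqP-> /eqP-> /eqP->.
Qed.

Lemma coordP {a} x : primitive_axis eta a ->
  exists u v, peirce a x (coord a x) u v.
Proof.
move=> pa; rewrite /coord; case: xgetP => [c ec|none]; first by [].
case: (pa) => -[_ [dec _] _] _ E1.
have [t [u [v []]]] := dec x; rewrite E1 => -[c _ <-] au av ex.
by case: (none c); exists u, v.
Qed.

Lemma coord_eq {a x c u v} : primitive_axis eta a ->
  peirce a x c u v -> coord a x = c.
Proof.
move=> pa px; have [u' [v' px']] := coordP x pa.
by have [] := peirce_uniq pa px' px.
Qed.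

Lemma coord_linear {a} : primitive_axis eta a -> forall k x y,
  coord a (k *: x + y) = k * coord a x + coord a y.
Proof.
move=> pa k x y.
have [u [v [au av ex]]] := coordP x pa.
have [u' [v' [au' av' ey]]] := coordP y pa.
apply: (@coord_eq _ _ _ (k *: u + u') (k *: v + v') pa); split.
- by rewrite !amulE au au' scalerDr !scalerA mulrC.
- by rewrite !amulE av av' scalerDr !scalerA mulrC.
by rewrite {1}ex {1}ey; by_coefs F A; ring.
Qed.

Lemma coord_axis {a} : primitive_axis eta a -> coord a a = 1.
Proof.
move=> pa; apply: (@coord_eq a a 1 0 0 pa).
by split; rewrite ?amul0r ?scaler0 // scale1r !addr0.
Qed.

Lemma coord_mul {a} x : primitive_axis eta a -> coord a (a ** x) = coord a x.
Proof.
move=> pa; have [u [v [au av ex]]] := coordP x pa.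
apply: (@coord_eq _ _ _ (eta *: u) (2^-1 *: v) pa).
by split; rewrite ?amulE ?au ?av // {1}ex !amulE au av prim_idem.
Qed.

Lemma coord_eta {a u} : primitive_axis eta a -> a ** u = eta *: u ->
  coord a u = 0.
Proof.
move=> pa au; apply: (@coord_eq _ _ _ u 0 pa).
by split; rewrite ?amul0r ?scaler0 // scale0r add0r addr0.
Qed.

Lemma coord_half {a v} : primitive_axis eta a -> a ** v = 2^-1 *: v ->
  coord a v = 0.
Proof.
move=> pa av; apply: (@coord_eq _ _ _ 0 v pa).
by split; rewrite ?amul0r ?scaler0 // scale0r !add0r.
Qed.

Lemma mul_eta_eta {a u u'} : primitive_axis eta a ->
  a ** u = eta *: u -> a ** u' = eta *: u' ->
  u ** u' = coord a (u ** u') *: a.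
Proof.
move=> pa au au'; case: (pa) => -[_ _ [_ [ee _ _]]] _ E1.
have: Defs.eigenspace 1 a (u ** u') by apply: ee; exists u => //; exists u'.
rewrite E1 => -[c _ ec]; rewrite (@coord_eq a _ c 0 0 pa) ?ec //.
by split; rewrite ?amul0r ?scaler0 // !addr0 ec.
Qed.

Lemma mul_eta_half {a u v} : primitive_axis eta a ->
  a ** u = eta *: u -> a ** v = 2^-1 *: v ->
  a ** (u ** v) = 2^-1 *: (u ** v).
Proof.
case=> -[_ _ [_ [_ eh _]]] _ E1 au av.
by apply: eh; exists u => //; exists v.
Qed.

Lemma mul_half_half {a v v'} : primitive_axis eta a ->
  a ** v = 2^-1 *: v -> a ** v' = 2^-1 *: v' ->
  exists2 w, a ** w = eta *: w & v ** v' = coord a (v ** v') *: a + w.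
Proof.
move=> pa av av'; case: (pa) => -[_ _ [_ [_ _ hh]]] _ E1.
have [|x + [w aw ew]] := hh (v ** v'); first by exists v => //; exists v'.
rewrite E1 => -[c _ ec]; exists w => //.
rewrite (@coord_eq a _ c w 0 pa); first by rewrite ec ew.
by split; rewrite ?amul0r ?scaler0 // addr0 ec ew.
Qed.

(** * Miyamoto involutions *)

(** The bracket is [(L_a - 1)(L_a - eta)] applied to [x]: it kills the eigenspaces for [1] and [eta]
    and acts on the half-eigenspace as [- (1 - 2 * eta) / 4]. The factor in front turns this into
    [-2], so only the half-component changes sign. Being a polynomial in [L_a], the map is linear
    without any choice of decomposition. *)
Definition miyamoto a x : A :=
  x + (8 / (1 - 2 * eta)) *: (a ** (a ** x) - (1 + eta) *: (a ** x) + eta *: x).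

Lemma miyamotoE {a x c u v} : primitive_axis eta a ->
  peirce a x c u v -> miyamoto a x = c *: a + u - v.
Proof.
move=> pa [au av ->]; rewrite /miyamoto !amulE au av !prim_idem // !amulE au av.
by by_coefs F A; field; rewrite ?two_neq0 ?eta2_neq1.
Qed.

Definition involutive_automorphism (f : A -> A) : Prop :=
  [/\ forall k x y, f (k *: x + y) = k *: f x + f y,
      forall x y, f (x ** y) = f x ** f y
    & forall x, f (f x) = x].

(** The fusion law is graded by Z/2, with the half-eigenspace as odd part, so changing the sign of
    that part respects products. *)
Lemma miyamoto_automorphism {a} : primitive_axis eta a ->
  involutive_automorphism (miyamoto a).
Proof.
move=> pa; split=> [k x y|x y|x].
- by rewrite /miyamoto !amulE; by_coefs F A; ring.
- have [u [v px]] := coordP x pa; have [u' [v' py]] := coordP y pa.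
  rewrite (miyamotoE pa px) (miyamotoE pa py).
  move: (coord a x) (coord a y) px py => c d [au av ->] [au' av' ->].
  have [w aw] := mul_half_half pa av av'; have := mul_eta_eta pa au au'.
  move: (coord a _) (coord a _) => p q euu evv.
  (* These are the Peirce components of the product. The same triple with [v] and [v'] negated
     serves the other side, since [v ** v'] is unaffected. *)
  rewrite !(@miyamotoE a _ (c * d + p + q)
    ((c * eta) *: u' + (d * eta) *: u + w)
    ((c / 2) *: v' + (d / 2) *: v + u ** v' + v ** u') pa).
    rewrite !amulE prim_idem // ![_ ** a]amulC au av au' av' euu evv.
    by by_coefs F A; ring.
  have av1 := mul_eta_half pa au av'.
  have := mul_eta_half pa au' av; rewrite [u' ** v]amulC => av2.
  split; first by rewrite !amulE au au' aw; by_coefs F A; ring.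
    by rewrite !amulE av av' av1 av2; by_coefs F A; ring.
  rewrite !amulE prim_idem // ![_ ** a]amulC au av au' av' euu evv.
  by by_coefs F A; ring.
- have [u [v [au av ex]]] := coordP x pa.
  rewrite (miyamotoE pa (And3 au av ex)).
  rewrite (@miyamotoE a _ (coord a x) u (- v)) //.
    by rewrite opprK.
  by split=> //; rewrite amulE av scalerN.
Qed.

Lemma automorphism_scale {f k x} : involutive_automorphism f ->
  f (k *: x) = k *: f x.
Proof.
case=> flin _ _; have f0: f 0 = 0.
  by have := flin (-1) 0 0; rewrite scaler0 addr0 scaleN1r addNr.
by rewrite -[k *: x]addr0 flin f0 addr0.
Qed.

Lemma automorphism_add {f x y} : involutive_automorphism f ->
  f (x + y) = f x + f y.
Proof. by case=> flin _ _; rewrite -[x in LHS]scale1r flin scale1r. Qed.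

Lemma automorphism_eigen {f k a x} : involutive_automorphism f ->
  a ** x = k *: x -> f a ** f x = k *: f x.
Proof.
by move=> af ax; case: (af) => _ fM _; rewrite -fM ax automorphism_scale.
Qed.

Lemma automorphism_eigen_inv {f k a x} : involutive_automorphism f ->
  f a ** x = k *: x -> a ** f x = k *: f x.
Proof.
by move=> af /(automorphism_eigen af); case: af => _ _ ff; rewrite ff.
Qed.

Lemma automorphism_prim {f a} : involutive_automorphism f ->
  primitive_axis eta a -> primitive_axis eta (f a).
Proof.
move=> af pa; have [[aa [dec indep] [[f11 f1e f1h] [fee feh fhh]]] a0 E1] := pa.
have [flin fM ff] := af.
have fD x y : f (x + y) = f x + f y by apply: automorphism_add.
have f0 : f 0 = 0 by have := @automorphism_scale f 0 0 af; rewrite !scale0r.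
(* As [f] is its own inverse, each eigenspace of [f a] is the preimage under [f] of the one of [a];
   all axioms are transported through this. *)
have eig k x : Defs.eigenspace k (f a) x <-> Defs.eigenspace k a (f x).
  split; first exact: automorphism_eigen_inv.
  by move/(automorphism_eigen af); rewrite ff.
have prod k l m : (prodset (Defs.eigenspace k a) (Defs.eigenspace l a) `<=`
      Defs.eigenspace m a)%classic ->
    (prodset (Defs.eigenspace k (f a)) (Defs.eigenspace l (f a)) `<=`
      Defs.eigenspace m (f a))%classic.
  move=> klm _ [x /eig ex [y /eig ey <-]]; apply/eig; rewrite fM.
  by apply: klm; exists (f x) => //; exists (f y).
split; first split.
- by rewrite -fM aa.
- split=> [x|u v w /eig eu /eig ev /eig ew s0].
    have [u [v [w [eu ev ew ex]]]] := dec (f x).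
    exists (f u), (f v), (f w); split; try (by apply/eig; rewrite ff).
    by rewrite -!fD -ex ff.
  have [||||E2 E3 E4] := indep (f u) (f v) (f w) => //.
    by rewrite -!fD s0 f0.
  by split; rewrite -[LHS]ff ?E2 ?E3 ?E4 f0.
- split; split; try exact: prod.
  move=> _ [x /eig ex [y /eig ey <-]].
  have [|z ez [w ew ezw]] := fhh (f x ** f y).
    by exists (f x) => //; exists (f y).
  exists (f z); first by apply/eig; rewrite ff.
  exists (f w); first by apply/eig; rewrite ff.
  by rewrite -fD ezw fM !ff.
- by apply: contra a0 => /eqP/(congr1 f); rewrite ff f0 => ->.
apply/seteqP; split=> x.
  move/eig; rewrite E1 => -[c _ ec]; exists c => //.
  by rewrite -automorphism_scale // ec ff.
case=> c _ <-; apply/eig; rewrite -automorphism_scale // ff E1.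
by exists c.
Qed.

Lemma coord_automorphism {f a} x : involutive_automorphism f ->
  primitive_axis eta a -> coord (f a) (f x) = coord a x.
Proof.
move=> af pa; have [u [v [au av ex]]] := coordP x pa.
apply: (@coord_eq _ _ _ (f u) (f v) (automorphism_prim af pa)).
split; try exact: automorphism_eigen.
case: (af) => flin _ _; rewrite {1}ex -addrA flin -addrA; congr (_ + _).
by rewrite automorphism_add.
Qed.

(** * The span of the primitive axes *)

Inductive axis_span : A -> Prop :=
  | axis_span0 : axis_span 0
  | axis_spanD c a x : primitive_axis eta a -> axis_span x ->
      axis_span (c *: a + x).

Lemma axis_span_lin k x y :
  axis_span x -> axis_span y -> axis_span (k *: x + y).
Proof.
move=> sx sy; elim: sx => [|c a z pa sz IH]; first by rewrite scaler0 add0r.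
by rewrite scalerDr scalerA -addrA; apply: axis_spanD.
Qed.

Lemma axis_span_axis a : primitive_axis eta a -> axis_span a.
Proof.
by move=> pa; rewrite -[a]addr0 -[a]scale1r; apply/axis_spanD/axis_span0.
Qed.

(* The Peirce components of an axis [b] relative to [a] are combinations of
   [a], [b] and the image of [b] under the Miyamoto involution of [a]. *)
Lemma axis_span_mul_axes a b : primitive_axis eta a -> primitive_axis eta b ->
  axis_span (a ** b).
Proof.
move=> pa pb; have [u [v pab]] := coordP b pa.
have pt := automorphism_prim (miyamoto_automorphism pa) pb.
have tb := miyamotoE pa pab; case: pab => au av eb.
(* With [c] the coordinate of [b], [v] is half of [b - miyamoto a b] and [u] is half of
   [b + miyamoto a b] minus [c *: a]; substitute in [c *: a + eta *: u + 2^-1 *: v]. *)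
have -> : a ** b = (coord a b * (1 - eta)) *: a
    + ((eta / 2 + 2^-1 * 2^-1) *: b
    + ((eta / 2 - 2^-1 * 2^-1) *: miyamoto a b + 0)).
  rewrite tb; move: (coord a b) eb => c ->; rewrite !amulE prim_idem // au av.
  by by_coefs F A; field.
by do 3!apply: axis_spanD => //; apply: axis_span0.
Qed.

Lemma axis_span_mul x y : axis_span x -> axis_span y -> axis_span (x ** y).
Proof.
move=> sx sy; elim: sx => [|c a z pa sz IH].
  by rewrite amul0l; apply: axis_span0.
rewrite amulDl amulZl; apply: axis_span_lin => //.
elim: sy => [|d b t pb st IHt]; first by rewrite amul0r; apply: axis_span0.
rewrite amulDr amulZr; apply: axis_span_lin => //.
exact: axis_span_mul_axes.
Qed.

(** The span of all primitive axes, not only of the given generators, is closed under products and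
    contains a generating set. *)
Lemma axis_spanT : primitive_axial_algebra A eta -> forall x, axis_span x.
Proof.
case=> X [_ Xprim gen] x.
have /seteqP[_] : [set x | axis_span x]%classic = setT; last exact.
apply: gen => [|a /Xprim]; last exact: axis_span_axis.
split; [exact: axis_span0 | exact: axis_span_lin | exact: axis_span_mul].
Qed.

(** * Two primitive axes *)

Lemma axis_pair_relations {a b u v} : primitive_axis eta a ->
  primitive_axis eta b -> peirce a b (coord a b) u v ->
  exists p q w, [/\ u ** u = p *: a, v ** v = q *: a + w & a ** w = eta *: w] /\
    [/\ p + q = coord a b - coord a b ^+ 2,
        w = (1 - 2 * coord a b * eta) *: u
      & u ** v = ((1 - coord a b) / 2) *: v].
Proof.
move=> pa pb [au av eb].
have [w aw] := mul_half_half pa av av; have := mul_eta_eta pa au au.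
have auv := mul_eta_half pa au av; have bb := prim_idem pb.
move: (coord a b) (coord a (u ** u)) (coord a (v ** v)) eb => c p q eb euu evv.
(* The three components of [b ** b - b] relative to [a]. *)
have [||| E1 E2 E3] := @peirce_indep a (c ^+ 2 + p + q - c)
  ((2 * c * eta - 1) *: u + w) ((c - 1) *: v + 2 *: (u ** v)) pa.
- by rewrite !amulE au aw; by_coefs F A; ring.
- by rewrite !amulE av auv; by_coefs F A; ring.
- transitivity (b ** b - b); last by rewrite bb subrr.
  rewrite eb !amulE (prim_idem pa) [u ** a]amulC [v ** a]amulC [v ** u]amulC.
  by rewrite au av euu evv; by_coefs F A; field.
exists p, q, w; do ![split=> //].
- by rewrite -[LHS]addr0 -[in LHS]oppr0 -E1; ring.
- by rewrite -[RHS]addr0 -E2; by_coefs F A; ring.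
- by rewrite -[RHS]addr0 -(scaler0 _ 2^-1) -E3; by_coefs F A; field.
Qed.

Lemma axis_pair_equations {a b u v p q w} (c := coord a b) (d := coord b a) :
  primitive_axis eta a -> primitive_axis eta b -> peirce a b c u v ->
  u ** u = p *: a -> v ** v = q *: a + w -> a ** w = eta *: w ->
  w = (1 - 2 * c * eta) *: u -> u ** v = ((1 - c) / 2) *: v ->
  [/\ c ^+ 2 + eta * p + q / 2 - (eta + 2^-1) * c + eta / 2
        = d * (1 - eta) / 2 * c,
      ((c - 1) * eta ^+ 2 + (1 - d) * (1 - eta) / 2) *: u = 0
    & ((c - d) * (1 - eta) / 2) *: v = 0].
Proof.
move=> pa pb [au av eb] euu evv aw ew euv.
(* The product of [L_b - eta] and [L_b - 2^-1] kills the [eta]- and half-components of [a] relative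
   to [b], and multiplies [b] by [(1 - eta) / 2]. *)
have key : b ** (b ** a) - (eta + 2^-1) *: (b ** a) + (eta / 2) *: a
    = (d * (1 - eta) / 2) *: b.
  have [u' [v' [bu bv ea]]] := coordP a pb; rewrite -/d in ea.
  rewrite ea !amulE bu bv !(prim_idem pb) !amulE bu bv.
  by by_coefs F A; field.
clearbody c d.
have [|||/eqP + -> ->] := @peirce_indep a
  (c ^+ 2 + eta * p + q / 2 - (eta + 2^-1) * c + eta / 2
    - d * (1 - eta) / 2 * c)
  (((c - 1) * eta ^+ 2 + (1 - d) * (1 - eta) / 2) *: u)
  (((c - d) * (1 - eta) / 2) *: v) pa.
- by rewrite amulZr au !scalerA mulrC.
- by rewrite amulZr av !scalerA mulrC.
- move/eqP: key; rewrite -subr_eq0 => /eqP <-; rewrite eb !amulE.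
  rewrite (prim_idem pa) [u ** a]amulC [v ** a]amulC au av !amulE.
  rewrite ?(prim_idem pa) ?au ?av [v ** u]amulC.
  by rewrite euu evv ew euv; by_coefs F A; field.
by rewrite subr_eq0 => /eqP.
Qed.

(** If [v] is non-zero, its coefficient gives [c = d] at once. If [v = 0] that equation is empty,
    and the remaining ones force [b = a], or else [c = - 2^-1] and [eta = -1]. *)
Lemma coord_axes {a b} : primitive_axis eta a -> primitive_axis eta b ->
  coord a b = coord b a /\ (eta != -1 -> coord a b = 1).
Proof.
move=> pa pb; have [u [v pab]] := coordP b pa.
have [p [q [w [[euu evv aw] [epq ew euv]]]]] := axis_pair_relations pa pb pab.
have [Ha Hu Hv] := axis_pair_equations pa pb pab euu evv aw ew euv.
have coord_ba : b = a -> coord b a = 1 by move=> ->; apply: coord_axis.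
have a0 := prim_neq0 pa; have b0 := prim_neq0 pb; case: pab => au av eb.
move: (coord a b) (coord b a) eb epq ew euv Ha Hu Hv coord_ba.
move=> c d eb epq ew euv Ha Hu Hv coord_ba.
have eta1 : 1 - eta != 0 by rewrite subr_eq0 eq_sym.
have eta2 := eta2_neq1.
have pa0 : u = 0 -> p = 0.
  move=> u0; move/esym/eqP: euu.
  by rewrite u0 amul0l scaler_eq0 (negPf a0) orbF => /eqP.
have [v0|v_neq0] := eqVneq v 0.
  have q0 : q = 0.
    move: evv aw; rewrite v0 amul0l => /esym s0 aw.
    have [] // := @peirce_indep a q w 0 pa aw.
      by rewrite amul0r scaler0.
    by rewrite addr0.
  rewrite q0 addr0 in epq.
  have [u0|u_neq0] := eqVneq u 0.
    move: epq eb; rewrite pa0 // u0 v0 !addr0 => /esym/eqP.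
    rewrite expr2 -{1}[c]mulr1 -mulrBr mulf_eq0 => /orP[/eqP->|].
      by rewrite scale0r => eb; rewrite eb eqxx in b0.
    rewrite subr_eq0 => /eqP <-; rewrite scale1r => ba.
    by rewrite coord_ba.
  have ce : 2 * c * eta = 1.
    move: evv; rewrite v0 q0 amul0l scale0r add0r ew => /esym/eqP.
    by rewrite scaler_eq0 (negPf u_neq0) orbF subr_eq0 => /eqP.
  move: Hu => /eqP; rewrite scaler_eq0 (negPf u_neq0) orbF => /eqP Hu.
  have c_neq0 : c != 0.
    by apply: contra_eq_neq ce => ->; rewrite mulr0 mul0r eq_sym oner_eq0.
  have ee : eta = (2 * c)^-1.
    by rewrite -[LHS](mulKf (x := 2 * c)) ?mulf_neq0 // ce mulr1.
  (* Subtracting [c] times [Hu] from [Ha] eliminates [d]; insert [p = c - c ^+ 2] and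
     [eta = (2 * c)^-1], then multiply by [2 * c]. *)
  have : (c - 1) ^+ 2 * (2 * c + 1) == 0.
    move/eqP: Ha; rewrite -subr_eq0 => /eqP Ha.
    rewrite -(mulr0 (2 * c)) -(subr0 0) -{1}Ha -(mulr0 c) -Hu epq q0 ee.
    by apply/eqP; field; rewrite c_neq0 two_neq0.
  rewrite mulf_eq0 expf_eq0 /= subr_eq0 => /orP[/eqP c1|].
    by move/eqP: ce; rewrite c1 mulr1 eq_sym -subr_eq0 (negPf eta2).
  rewrite addr_eq0 => /eqP c2.
  have etaN1 : eta = -1 by rewrite ee c2 invrN invr1.
  split; last by rewrite etaN1 eqxx.
  have cE : c = - 2^-1 by rewrite -[LHS](mulKf two_neq0) c2 mulrN1.
  rewrite cE -[RHS]addr0 -Hu etaN1 cE.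
  by field.
move: Hv => /eqP; rewrite scaler_eq0 (negPf v_neq0) orbF.
rewrite !mulf_eq0 invr_eq0 (negPf two_neq0) (negPf eta1) !orbF subr_eq0.
move/eqP=> cd; split=> // etaN1; subst d.
have [u0|u_neq0] := eqVneq u 0.
  move: euv => /esym/eqP; rewrite u0 amul0l scaler_eq0 (negPf v_neq0) orbF.
  by rewrite mulf_eq0 invr_eq0 (negPf two_neq0) orbF subr_eq0 => /eqP.
move: Hu => /eqP; rewrite scaler_eq0 (negPf u_neq0) orbF => /eqP Hu.
(* This is [-2] times [Hu] at [d = c]. *)
have : (c - 1) * ((1 + eta) * (1 - 2 * eta)) == 0.
  by rewrite -(mulr0 (- 2)) -Hu; apply/eqP; field.
rewrite !mulf_eq0 (negPf eta2) orbF subr_eq0 => /orP[/eqP //|].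
by rewrite addrC addr_eq0 (negPf etaN1).
Qed.

(** * The invariant form *)

Hypothesis spanT : forall x, axis_span x.

Lemma linear_at0 {f : A -> F} :
  (forall k x y, f (k *: x + y) = k * f x + f y) ->
  f 0 = 0.
Proof.
by move=> flin; have := flin (-1) 0 0; rewrite scaler0 addr0 mulN1r addNr.
Qed.

Lemma lin_eq_on_axes {f g : A -> F} :
  (forall k x y, f (k *: x + y) = k * f x + f y) ->
  (forall k x y, g (k *: x + y) = k * g x + g y) ->
  (forall a, primitive_axis eta a -> f a = g a) -> forall x, f x = g x.
Proof.
move=> flin glin fg x; elim: (spanT x) => [|c a y pa _ IH].
  by rewrite !linear_at0.
by rewrite flin glin fg // IH.
Qed.

Lemma axis_form_exists : exists phi : A -> A -> F,
  [/\ forall k x y z, phi (k *: x + y) z = k * phi x z + phi y z,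
      forall x y, phi x y = phi y x
    & forall a x, primitive_axis eta a -> phi a x = coord a x].
Proof.
(* Writing [x] as a combination of axes gives a functional that may seem to depend on that
   expression. By the symmetry in [coord_axes] its value at an axis [b] is [coord b x], which
   depends on [x] alone; this is what makes the chosen [phi] linear in [x]. *)
have /choice[phi phiP] : forall x, exists f : A -> F,
    (forall k y z, f (k *: y + z) = k * f y + f z) /\
    (forall b, primitive_axis eta b -> f b = coord b x).
  move=> x; elim: (spanT x) => [|c a y pa _ [f [flin fb]]].
    exists (fun=> 0); split=> [k _ _|b pb]; first by rewrite mulr0 addr0.
    by rewrite linear_at0 //; apply: coord_linear.
  exists (fun z => c * coord a z + f z); split=> [k z t|b pb].
    by rewrite flin coord_linear //; ring.
  by rewrite coord_linear // fb // (coord_axes pa pb).1.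
have lin2 x := (phiP x).1.
have phi_axis x b : primitive_axis eta b -> phi x b = coord b x.
  exact: (phiP x).2.
have lin1 k x y z : phi (k *: x + y) z = k * phi x z + phi y z.
  move: z; apply: lin_eq_on_axes => [//|l z t|a pa].
    by rewrite !lin2; ring.
  by rewrite !phi_axis // coord_linear.
have phi_axisl a x : primitive_axis eta a -> phi a x = coord a x.
  move=> pa; move: x; apply: lin_eq_on_axes => [//||b pb].
    exact: coord_linear.
  by rewrite phi_axis // (coord_axes pa pb).1.
exists phi; split=> // x y; move: x; apply: lin_eq_on_axes => [k x z|//|a pa].
  exact: lin1.
by rewrite phi_axisl // phi_axis.
Qed.

Section Form.

Context {phi : A -> A -> F}.
Hypothesis phi_linear_l :
  forall k x y z, phi (k *: x + y) z = k * phi x z + phi y z.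
Hypothesis phi_sym : forall x y, phi x y = phi y x.
Hypothesis phi_axis : forall a x, primitive_axis eta a -> phi a x = coord a x.

Lemma form_linear_r k x y z : phi z (k *: x + y) = k * phi z x + phi z y.
Proof. by rewrite phi_sym phi_linear_l !(phi_sym z). Qed.

Lemma form_addl x y z : phi (x + y) z = phi x z + phi y z.
Proof. by have := phi_linear_l 1 x y z; rewrite scale1r mul1r. Qed.

Lemma form_addr x y z : phi z (x + y) = phi z x + phi z y.
Proof. by rewrite !(phi_sym z) form_addl. Qed.

Lemma form0l x : phi 0 x = 0.
Proof. exact: (linear_at0 (fun k y z => phi_linear_l k y z x)). Qed.

Lemma form_scalel k x z : phi (k *: x) z = k * phi x z.
Proof. by rewrite -[k *: x]addr0 phi_linear_l form0l addr0. Qed.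

Lemma form_scaler k x z : phi z (k *: x) = k * phi z x.
Proof. by rewrite !(phi_sym z) form_scalel. Qed.

Lemma form_miyamoto a x y : primitive_axis eta a ->
  phi (miyamoto a x) (miyamoto a y) = phi x y.
Proof.
move=> pa; have tau := miyamoto_automorphism pa; have [tlin _ _] := tau.
move: x; apply: lin_eq_on_axes => [k x z|k x z|b pb].
- by rewrite tlin phi_linear_l.
- exact: phi_linear_l.
rewrite !phi_axis //; first exact: coord_automorphism.
exact: automorphism_prim.
Qed.

(** The involution of [a] fixes [u], negates [v] and preserves [phi], so [phi u v] equals its own
    opposite. *)
Lemma form_eta_half {a u v} : primitive_axis eta a ->
  a ** u = eta *: u -> a ** v = 2^-1 *: v -> phi u v = 0.
Proof.
move=> pa au av; have := form_miyamoto a u v pa.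
rewrite (@miyamotoE a u 0 u 0 pa); last first.
  by split; rewrite ?amul0r ?scaler0 // scale0r add0r addr0.
rewrite (@miyamotoE a v 0 0 v pa); last first.
  by split; rewrite ?amul0r ?scaler0 // scale0r !add0r.
rewrite scale0r !add0r subr0 -scaleN1r form_scaler mulN1r => /eqP.
rewrite eq_sym -subr_eq0 opprK -mulr2n -mulr_natl mulf_eq0 (negPf two_neq0).
by move/eqP.
Qed.

(** For [x] an axis this is self-adjointness of [L_x], which holds because its eigenspaces are
    mutually orthogonal; linearity in [x] does the rest. *)
Lemma form_assoc x y z : phi (x ** y) z = phi y (x ** z).
Proof.
move: x; apply: lin_eq_on_axes => [k x t|k x t|a pa].
- by rewrite amulDl amulZl phi_linear_l.
- by rewrite amulDl amulZl form_linear_r.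
have phia := phi_axis a ^~ pa.
have [u [v [au av ->]]] := coordP y pa.
have [u' [v' [au' av' ->]]] := coordP z pa.
rewrite !amulE au av au' av' prim_idem //.
rewrite !(form_addl, form_addr, form_scalel, form_scaler).
rewrite (form_eta_half pa au av') [phi v u']phi_sym (form_eta_half pa au' av).
rewrite [phi u a]phi_sym [phi v a]phi_sym !phia.
rewrite (coord_eta pa au) (coord_eta pa au') (coord_half pa av).
by rewrite (coord_half pa av'); ring.
Qed.

(** * The cubic identity common to both cases *)

Section CubicIdentity.

Context {omega : A -> F}.
Hypothesis omega_linear :
  forall k x y, omega (k *: x + y) = k * omega x + omega y.
(* The factor [1 + eta] makes this vacuous when [eta = -1]. *)
Hypothesis omega_axis : forall a x, primitive_axis eta a ->
  (1 + eta) * omega x = (1 + eta) * coord a x.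

(** Up to the factor [1 + eta], all coordinate functionals agree with [omega], so a vector with one
    vanishing coordinate is orthogonal to every axis. *)
Lemma form_coord0 {a y z} : primitive_axis eta a -> coord a y = 0 ->
  (1 + eta) * phi y z = 0.
Proof.
move=> pa y0; move: z; apply: (@lin_eq_on_axes _ (fun=> 0)).
- by move=> k x z; rewrite form_linear_r; ring.
- by move=> *; ring.
move=> b pb; rewrite phi_sym phi_axis // -omega_axis // (omega_axis a) //.
by rewrite y0 mulr0.
Qed.

(* Polarization of [cubic_identity] below. *)
Definition cubic x y z : A :=
  (x ** y) ** z + (y ** z) ** x + (z ** x) ** y
  - (1 + eta) *: (omega x *: (y ** z) + omega y *: (z ** x)
                  + omega z *: (x ** y))
  + eta *: (phi y z *: x + phi z x *: y + phi x y *: z).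

Lemma cubic_linear k x t y z :
  cubic (k *: x + t) y z = k *: cubic x y z + cubic t y z.
Proof.
rewrite /cubic !amulE omega_linear form_linear_r phi_linear_l.
by by_coefs F A; ring.
Qed.

Lemma cubic_axis a y z : primitive_axis eta a -> cubic a y z = 0.
Proof.
move=> pa; have phia := phi_axis a ^~ pa; have omegaa := omega_axis a ^~ pa.
rewrite /cubic !scalerDr !scalerA !omegaa [phi z a]phi_sym !phia coord_axis //.
rewrite [z ** a]amulC [y ** z ** a]amulC.
have [u [v []]] := coordP y pa; have [u' [v' []]] := coordP z pa.
move: (coord a y) (coord a z) => c d au' av' -> au av ->.
have [w aw] := mul_half_half pa av av'; have := mul_eta_eta pa au au'.
have auv' := mul_eta_half pa au av'; have := mul_eta_half pa au' av.
(* Associativity of the form evaluates the coordinates: that of [u ** u'] is [eta * phi u u'], that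
   of [v ** v'] is half of [phi v v']. *)
rewrite [u' ** v]amulC -!phia -!form_assoc [u ** a]amulC [v ** a]amulC.
rewrite au av !form_scalel => avu' euu' evv'.
have P0 := @form_coord0 _ _ u' pa (coord_eta pa au).
have Q0 := @form_coord0 _ _ v' pa (coord_half pa av).
rewrite !(form_addl, form_addr, form_scalel, form_scaler).
rewrite (form_eta_half pa au av') [phi v u']phi_sym (form_eta_half pa au' av).
rewrite [phi u a]phi_sym [phi v a]phi_sym !phia coord_axis //.
rewrite (coord_eta pa au) (coord_eta pa au').
rewrite (coord_half pa av) (coord_half pa av').
rewrite !amulE (prim_idem pa) au av au' av' !amulE (prim_idem pa).
rewrite [u ** a]amulC [v ** a]amulC [u' ** a]amulC [v' ** a]amulC.
rewrite [u' ** u]amulC [v' ** v]amulC [u' ** v]amulC [v' ** u]amulC.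
rewrite au av au' av' euu' evv' !amulE auv' avu' (prim_idem pa) aw au av.
(* All other terms cancel; what is left carries the factor [1 + eta] and vanishes by
   [form_coord0]. *)
transitivity ((eta * ((1 + eta) * phi u u') + (1 + eta) * phi v v' / 2) *: a).
  by by_coefs F A; field.
by rewrite P0 Q0 mulr0 mul0r addr0 scale0r.
Qed.

Lemma cubic_identity x :
  (x ** x) ** x - ((1 + eta) * omega x) *: (x ** x) + (eta * phi x x) *: x = 0.
Proof.
have cub y z : cubic x y z = 0.
  elim: (spanT x) => [|c a t pa _ IH]; last first.
    by rewrite cubic_linear cubic_axis // IH scaler0 addr0.
  have := cubic_linear (-1) 0 0 y z.
  by rewrite scaler0 addr0 scaleN1r addNr.
(* On the diagonal [cubic] is three times the left-hand side. *)
apply: (scalerI three_neq0); rewrite scaler0 -[RHS](cub x x) /cubic.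
by by_coefs F A; ring.
Qed.

End CubicIdentity.
End Form.
End PrimitiveAxes.

(** * The characteristic hypotheses and the two cases of the theorem *)

Lemma notin_pchar_neq0 {F : fieldType} {p : nat} :
  prime p -> p \notin [pchar F] -> p%:R != 0 :> F.
Proof. by move=> pp; rewrite inE pp. Qed.

Theorem theorem1p1 (F : fieldType)
    (char_not2 : 2%N \notin [pchar F]) (char_not3 : 3%N \notin [pchar F])
    (eta : F) (eta_neq1 : eta != 1) (eta_neq_half : eta != 2^-1)
    (A : comAlg F) (A_axial : primitive_axial_algebra A eta) :
  (eta = -1 -> pseudo_composition_algebra A) /\
  (eta != -1 -> train_algebra_rank3 A).
Proof.
have two := @notin_pchar_neq0 _ 2 isT char_not2.
have three := @notin_pchar_neq0 _ 3 isT char_not3.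
have span := axis_spanT two eta_neq_half A_axial.
have [phi [phil phis phia]] := axis_form_exists two eta_neq1 eta_neq_half span.
have [a pa] : exists a : A, primitive_axis eta a.
  by case: A_axial => X [[a Xa] Xprim _]; exists a; apply: Xprim.
have phir := form_linear_r phil phis.
split=> [etaN1|eta_neqN1].
  have phib : bilinear_for *%R *%R phi.
    split=> [x k y z|x k y z] /=; first exact: phil.
    exact: phir.
  (* Symmetry in Hermitian form: trivial sign, identity as field automorphism. *)
  have phih x y : phi x y = (-1) ^+ false * idfun (phi y x).
    by rewrite expr0 mul1r phis.
  pose phi_form : {symmetric A} := HB.pack_for {symmetric A} phi
    (bilinear_isBilinear.Build F A A F *%R *%R phi phib)
    (isHermitianSesquilinear.Build F A false idfun phi phih).
  exists phi_form; split.
    by exists a, a; rewrite /= phia // coord_axis // oner_neq0.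
  move=> x; have eta0 : 1 + eta = 0 by rewrite etaN1 subrr.
  (* Since [1 + eta = 0], the zero functional can serve as [omega], and the quadratic term
     disappears. *)
  have omega_axis (b y : A) : primitive_axis eta b ->
      (1 + eta) * 0 = (1 + eta) * coord (eta := eta) b y.
    by rewrite eta0 !mul0r.
  have zero_linear (k : F) (y z : A) : 0 = k * 0 + 0 :> F.
    by rewrite mulr0 addr0.
  have := cubic_identity two three eta_neq_half span phil phis phia
    zero_linear omega_axis x.
  rewrite mulr0 scale0r subr0 etaN1 mulN1r scaleNr => /eqP.
  by rewrite subr_eq0 => /eqP.
have eta_unit : 1 + eta != 0 by rewrite addrC addr_eq0.
pose omega_lin := GRing.isLinear.Build F A F *%R (phi a)
  (fun k x y => phir k x y a).
pose omega : {scalar A} := HB.pack_for {scalar A} (phi a) omega_lin.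
(* Any two axes have coordinate [1] relative to each other, so the functionals [phi b] and [phi a]
   agree on the spanning axes. *)
have phi_a (b y : A) : primitive_axis eta b -> phi b y = phi a y.
  move=> pb; rewrite phis (phis a); move: y; apply: (lin_eq_on_axes span).
  - by move=> k x y; apply: phil.
  - by move=> k x y; apply: phil.
  move=> c pc; rewrite !phia //.
  by rewrite !(coord_axes two eta_neq1 eta_neq_half pc _).2.
(* The form degenerates to a product of two copies of [omega], which turns [phi x x] into
   [omega x ^+ 2]. *)
have phiM x y : phi x y = phi a x * phi a y.
  move: x; apply: (lin_eq_on_axes span) => [k x z|k x z|b pb].
  - exact: phil.
  - by rewrite phir; ring.
  rewrite phi_a // (phia a b) //.
  by rewrite (coord_axes two eta_neq1 eta_neq_half pa pb).2 // mul1r.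
exists omega, (- (1 + eta)), eta; split.
(* For [x] an axis [b], [omega] may be replaced by [coord b], which multiplication by [b]
   preserves. *)
- move=> x y /=; rewrite -phiM; move: x; apply: (lin_eq_on_axes span).
  + by move=> k x z; rewrite amulDl amulZl phir.
  + by move=> k x z; apply: phil.
  by move=> b pb; rewrite -(phi_a b) // !phia // coord_mul.
- by exists a; rewrite /= phia // coord_axis // oner_neq0.
move=> x; have omega_axis (b y : A) : primitive_axis eta b ->
    (1 + eta) * phi a y = (1 + eta) * coord (eta := eta) b y.
  by move=> pb; rewrite -phia // phi_a.
have := cubic_identity two three eta_neq_half span phil phis phia
  (fun k x y => phir k x y a) omega_axis x.
by rewrite (phiM x x) -expr2 -scaleNr -mulNr.
Qed.
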